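(* Let $\{S_n\}_{n\ge 0}$ be a sequence of positive reals satisfying $S_n = a(n)S_{n-1} + b(n)S_{n-2}$ for all $n\ge 2$, where $a(n),b(n)$ are real. Define $$c_0(n) = -b^2(n+1)\big[a^2(n+2) + b(n+1) - a(n+2)a(n+3) - b(n+3)\big];$$ $$c_1(n) = b(n+1)\big[2a(n+2)b(n+1) + 2a(n+3)a(n+2)a(n+1) + a(n+3)b(n+2) + 2a(n+1)b(n+3) - 2a^2(n+2)a(n+1) - 2a(n+2)b(n+2) - 3a(n+1)b(n+1)\big];$$ $$\begin{aligned}c_2(n) ={}& 4a(n+1)a(n+2)b(n+1) + 2b(n+1)b(n+2) + a^2(n+1)a(n+2)a(n+3) + a(n+1)a(n+3)b(n+2) + a^2(n+1)b(n+3) \\ &- 3a^2(n+1)b(n+1) - a(n+3)a(n+2)b(n+1) - a^2(n+2)a^2(n+1) - b(n+3)b(n+1) - 2a(n+2)a(n+1)b(n+2) - b^2(n+2);\end{aligned}$$ $$c_3(n) = 2a^2(n+1)a(n+2) + 2a(n+1)b(n+2) - a(n+1)b(n+3) - a^3(n+1) - a(n+1)a(n+2)a(n+3) - a(n+3)b(n+2);$$ and $\Delta(n) = 4c_2^2(n) - 12c_1(n)c_3(n)$. Suppose that there is a positive integer $N$ with $c_3(n)>0$ and $\Delta(n)>0$ for all $n\ge N$. If there exists a function $f(n)$ such that for all $n\ge N$: (I) $S_n/S_{n-1} \ge f(n)$; (II) $f(n) \ge \dfrac{-2c_2(n) + \sqrt{\Delta(n)}}{6c_3(n)}$; (III) $c_3(n)f(n)^3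 + c_2(n)f(n)^2 + c_1(n)f(n) + c_0(n) > 0$, then the sequence $\{S_n^2 - S_{n-1}S_{n+1}\}_{n\ge N}$ is strictly log-convex; namely, for all $n\ge N$, $$(S_{n+1}^2 - S_nS_{n+2})^2 < (S_n^2 - S_{n-1}S_{n+1})(S_{n+2}^2 - S_{n+1}S_{n+3}).$$ *)

(* Defs.v *)
From Stdlib Require Import Reals.
Open Scope R_scope.

Definition c_0 (a b : nat -> R) (n : nat) : R :=
  - b (n+1)%nat ^ 2 *
    (a (n+2)%nat ^ 2 + b (n+1)%nat - a (n+2)%nat * a (n+3)%nat - b (n+3)%nat).

Definition c_1 (a b : nat -> R) (n : nat) : R :=
  b (n+1)%nat *
    (2 * a (n+2)%nat * b (n+1)%nat
     + 2 * a (n+3)%nat * a (n+2)%nat * a (n+1)%nat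
     + a (n+3)%nat * b (n+2)%nat
     + 2 * a (n+1)%nat * b (n+3)%nat
     - 2 * a (n+2)%nat ^ 2 * a (n+1)%nat
     - 2 * a (n+2)%nat * b (n+2)%nat
     - 3 * a (n+1)%nat * b (n+1)%nat).

Definition c_2 (a b : nat -> R) (n : nat) : R :=
  4 * a (n+1)%nat * a (n+2)%nat * b (n+1)%nat
  + 2 * b (n+1)%nat * b (n+2)%nat
  + a (n+1)%nat ^ 2 * a (n+2)%nat * a (n+3)%nat
  + a (n+1)%nat * a (n+3)%nat * b (n+2)%nat
  + a (n+1)%nat ^ 2 * b (n+3)%nat
  - 3 * a (n+1)%nat ^ 2 * b (n+1)%nat
  - a (n+3)%nat * a (n+2)%nat * b (n+1)%nat
  - a (n+2)%nat ^ 2 * a (n+1)%nat ^ 2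
  - b (n+3)%nat * b (n+1)%nat
  - 2 * a (n+2)%nat * a (n+1)%nat * b (n+2)%nat
  - b (n+2)%nat ^ 2.

Definition c_3 (a b : nat -> R) (n : nat) : R :=
  2 * a (n+1)%nat ^ 2 * a (n+2)%nat
  + 2 * a (n+1)%nat * b (n+2)%nat
  - a (n+1)%nat * b (n+3)%nat
  - a (n+1)%nat ^ 3
  - a (n+1)%nat * a (n+2)%nat * a (n+3)%nat
  - a (n+3)%nat * b (n+2)%nat.

Definition Delta_c (a b : nat -> R) (n : nat) : R :=
  4 * c_2 a b n ^ 2 - 12 * c_1 a b n * c_3 a b n.

(* Main.v *)
(** Put [x = S_n], [y = S_(n-1)].  The recurrence makes the difference of the
    two sides a quartic form in [x, y], which factors as [S_(n+1)] times the
    homogenised cubic [c3 x^3 + c2 x^2 y + c1 x y^2 + c0 y^3].  So only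
    positivity of the cubic at [x / y] is needed.  Condition (II) places [f n]
    to the right of the larger critical point of the cubic, beyond which it is
    increasing, hence its value at [x / y >= f n] is at least its value at
    [f n], which is positive by (III). *)

Require Import Defs.
From Stdlib Require Import Reals Lra Lia.
Open Scope R_scope.

(** Taylor expansion at the larger critical point [c]: with [w = t - c] the cubic in [t] becomes
    [p w^3 + (d/2) w^2 + const], where [d >= 0] is the square root, and this increases for
    [w >= 0]. *)
Lemma cubic_increasing_right_of_critical_point (p q r s u v : R) :
  0 < p -> 0 <= 4 * q ^ 2 - 12 * r * p ->
  (-2 * q + sqrt (4 * q ^ 2 - 12 * r * p)) / (6 * p) <= u -> u <= v ->
  p * u ^ 3 + q * u ^ 2 + r * u + s <= p * v ^ 3 + q * v ^ 2 + r * v + s.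
Proof.
  intros p_pos D_ge0 cu uv.
  set (d := sqrt (4 * q ^ 2 - 12 * r * p)) in *.
  assert (d_ge0 : 0 <= d) by apply sqrt_pos.
  assert (d_sqr : d * d = 4 * q ^ 2 - 12 * r * p) by now apply sqrt_sqrt.
  set (c := (-2 * q + d) / (6 * p)) in *.
  (* [qE] says that the second derivative at [c] is [d]; with it, [rE] says that the first
     derivative there vanishes. *)
  assert (qE : q = d / 2 - 3 * p * c) by (unfold c; field; lra).
  assert (rE : r = 3 * p * c ^ 2 - d * c).
  { apply (Rmult_eq_reg_l (12 * p)); [| lra].
    replace (12 * p * r) with (4 * q ^ 2 - d * d) by (rewrite d_sqr; ring).
    rewrite qE; field. }
  (* The quantity shown nonnegative is the value at [v] minus the value at [u], factored in the
     shifted variable. *)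
  assert (slope_ge0 :
    0 <= (v - u) * (p * ((u - c) ^ 2 + (u - c) * (v - c) + (v - c) ^ 2)
                    + d / 2 * ((u - c) + (v - c)))).
  { apply Rmult_le_pos; [lra |].
    apply Rplus_le_le_0_compat; apply Rmult_le_pos; try lra.
    assert (0 <= (u - c) * (v - c)) by (apply Rmult_le_pos; lra).
    pose proof (pow2_ge_0 (u - c)); pose proof (pow2_ge_0 (v - c)); lra. }
  rewrite qE, rE; lra.
Qed.

Lemma log_convexity_defect_factor (a b : nat -> R) (n : nat) (x y x1 x2 x3 : R) :
  x1 = a (n+1)%nat * x + b (n+1)%nat * y ->
  x2 = a (n+2)%nat * x1 + b (n+2)%nat * x ->
  x3 = a (n+3)%nat * x2 + b (n+3)%nat * x1 ->
  (x ^ 2 - y * x1) * (x2 ^ 2 - x1 * x3) - (x1 ^ 2 - x * x2) ^ 2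
  = x1 * (c_3 a b n * x ^ 3 + c_2 a b n * x ^ 2 * y
          + c_1 a b n * x * y ^ 2 + c_0 a b n * y ^ 3).
Proof.
  intros -> -> ->; unfold c_3, c_2, c_1, c_0; ring.
Qed.

Theorem theorem3p1 (S a b : nat -> R)
  (S_pos : forall n : nat, 0 < S n)
  (S_rec : forall n : nat, (2 <= n)%nat ->
     S n = a n * S (n-1)%nat + b n * S (n-2)%nat)
  (N : nat) (N_pos : (0 < N)%nat)
  (c3_Delta_pos : forall n : nat, (N <= n)%nat ->
     0 < c_3 a b n /\ 0 < Delta_c a b n)
  (f_ex : exists f : nat -> R, forall n : nat, (N <= n)%nat ->
     S n / S (n-1)%nat >= f n
     /\ f n >= (-2 * c_2 a b n + sqrt (Delta_c a b n)) / (6 * c_3 a b n)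
     /\ c_3 a b n * f n ^ 3 + c_2 a b n * f n ^ 2
        + c_1 a b n * f n + c_0 a b n > 0) :
  forall n : nat, (N <= n)%nat ->
    (S (n+1)%nat ^ 2 - S n * S (n+2)%nat) ^ 2
    < (S n ^ 2 - S (n-1)%nat * S (n+1)%nat)
      * (S (n+2)%nat ^ 2 - S (n+1)%nat * S (n+3)%nat).
Proof.
  intros n Nn.
  destruct f_ex as [f f_spec].
  destruct (f_spec n Nn) as [f_le [f_ge f_pos]].
  destruct (c3_Delta_pos n Nn) as [c3_pos D_pos].
  unfold Delta_c in f_ge, D_pos.
  (* [N_pos] gives [n >= 1], so the recurrence already applies at index [n+1 >= 2]. *)
  assert (rec1 : S (n+1)%nat = a (n+1)%nat * S n + b (n+1)%nat * S (n-1)%nat).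
  { rewrite (S_rec (n+1)%nat) by lia.
    now replace (n+1-1)%nat with n by lia; replace (n+1-2)%nat with (n-1)%nat by lia. }
  assert (rec2 : S (n+2)%nat = a (n+2)%nat * S (n+1)%nat + b (n+2)%nat * S n).
  { rewrite (S_rec (n+2)%nat) by lia.
    now replace (n+2-1)%nat with (n+1)%nat by lia; replace (n+2-2)%nat with n by lia. }
  assert (rec3 : S (n+3)%nat = a (n+3)%nat * S (n+2)%nat + b (n+3)%nat * S (n+1)%nat).
  { rewrite (S_rec (n+3)%nat) by lia.
    now replace (n+3-1)%nat with (n+2)%nat by lia;
      replace (n+3-2)%nat with (n+1)%nat by lia. }
  apply Rlt_0_minus.
  rewrite (log_convexity_defect_factor a b n _ _ _ _ _ rec1 rec2 rec3).
  apply Rmult_lt_0_compat; [apply S_pos |].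
  pose proof (S_pos (n-1)%nat) as y_pos.
  set (x := S n) in *; set (y := S (n-1)%nat) in *.
  (* Dehomogenise: pulling out [y^3 > 0] leaves the cubic at the ratio bounded below in (I). *)
  replace (c_3 a b n * x ^ 3 + c_2 a b n * x ^ 2 * y
           + c_1 a b n * x * y ^ 2 + c_0 a b n * y ^ 3)
    with (y ^ 3 * (c_3 a b n * (x / y) ^ 3 + c_2 a b n * (x / y) ^ 2
                   + c_1 a b n * (x / y) + c_0 a b n))
    by (field; lra).
  apply Rmult_lt_0_compat; [now apply pow_lt |].
  eapply Rlt_le_trans; [exact f_pos |].
  apply cubic_increasing_right_of_critical_point; lra.
Qed.
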